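(* Let $\mathbf{p}_1,\mathbf{p}_2\in\mathbb{Z}^n$ be linearly independent vectors with positive entries and let $\mathbf{r}\in\mathbb{Z}^n$. Suppose that Procedure CKP (described in the context), run on the input $\mathbf{p}_1,\mathbf{p}_2,\mathbf{r}$, is such that the quantities $M_2$, $(\beta_2',\beta_2)$ and $M_1$ it defines all exist, and let $M_1,M_2,k_1,k_2,\beta',\beta$ and $\mathbf{a}=\mathbf{p}_1M_1+\mathbf{p}_2M_2+\mathbf{r}$ be the resulting quantities. Then the integer infeasibility of (CKP) is proven by $(\mathbf{p}_1\mathbf{x}=k_1+1)\wedge(\mathbf{p}_2\mathbf{x}\le k_2\ \vee\ \mathbf{p}_2\mathbf{x}\ge k_2+1)$. That is, writing $Q=\{\mathbf{x}\in\mathbb{R}^n\mid\beta'\le\mathbf{a}\mathbf{x}\le\beta,\ \mathbf{0}\le\mathbf{x}\le\mathbf{1}\}$ for the LP relaxation of (CKP): (i) no $\mathbf{x}\in Q$ satisfies $\mathbf{p}_1\mathbf{x}\le k_1$ or $\mathbf{p}_1\mathbf{x}\ge k_1+2$ (so $\mathbf{p}_1\mathbf{x}=k_1+1$ is the only possible branch when branching on integer values of $\mathbf{p}_1\mathbf{x}$); and (ii) no $\mathbf{x}\in Q$ with $\mathbf{p}_1\mathbf{x}=k_1+1$ satisfies $\mathbf{p}_2\mathbf{x}\le k_2$ or $\mathbf{p}_2\mathbf{x}\ge k_2+1$. Consequently $Q\cap\mathbb{Z}^n=\emptyset$.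
   Context: Notation. For $x\in\mathbb{R}$ let $\lfloor x\rfloor^{-}$ denote the largest integer strictly less than $x$ (that is, $\lfloor x\rfloor$ if $x\notin\mathbb{Z}$ and $x-1$ if $x\in\mathbb{Z}$), and let $\lceil x\rceil^{+}$ denote the smallest integer strictly greater than $x$ (that is, $\lceil x\rceil$ if $x\notin\mathbb{Z}$ and $x+1$ if $x\in\mathbb{Z}$). $\lfloor x\rceil$ denotes rounding to a nearest integer. $\mathbf{1}$ is the all-ones vector and $B_{\mathbf 1}=\{\mathbf{x}\in\mathbb{R}^n\mid \mathbf{0}\le\mathbf{x}\le\mathbf{1}\}$. For vectors $\mathbf{c},\mathbf{x}\in\mathbb{R}^n$, $\mathbf{c}\mathbf{x}$ denotes $\sum_j c_jx_j$. Procedure CKP. Input: linearly independent $\mathbf{p}_1,\mathbf{p}_2\in\mathbb{Z}^n$ with positive entries, and $\mathbf{r}\in\mathbb{Z}^n$. Step 1. Let $\gamma_1=\max\{\mathbf{p}_1\mathbf{x}\mid\mathbf{x}\in B_{\mathbf 1}\}$, $\delta_1=\min\{\mathbf{p}_1\mathbf{x}\mid\mathbf{x}\in B_{\mathbf 1}\}$ and $k_1=\lfloor(\lfloor\gamma_1\rfloor^{-}+\lceil\delta_1\rceil^{+})/2\rceil$. Let $\gamma_2=\max\{\mathbf{p}_2\mathbf{x}\mid\mathbf{p}_1\mathbf{x}=k_1+1,\ \mathbf{x}\in B_{\mathbf 1}\}$, $\delta_2=\min\{\mathbf{p}_2\mathbf{x}\mid\mathbf{p}_1\mathbf{x}=k_1+1,\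 \mathbf{x}\in B_{\mathbf 1}\}$ and $k_2=\lfloor(\lfloor\gamma_2\rfloor^{-}+\lceil\delta_2\rceil^{+})/2\rceil$. Step 2. Let $\eta_2=\max\{\mathbf{r}\mathbf{x}\mid\mathbf{p}_1\mathbf{x}=k_1+1,\ \mathbf{p}_2\mathbf{x}\le k_2,\ \mathbf{x}\in B_{\mathbf 1}\}$ and $\mu_2=\min\{\mathbf{r}\mathbf{x}\mid\mathbf{p}_1\mathbf{x}=k_1+1,\ \mathbf{p}_2\mathbf{x}\ge k_2+1,\ \mathbf{x}\in B_{\mathbf 1}\}$. If $\lceil\eta_2\rceil^{+}-\lfloor\mu_2\rfloor^{-}\ge1$, set $M_2=\lceil\eta_2\rceil^{+}-\lfloor\mu_2\rfloor^{-}$ and $\mathbf{a}_2=\mathbf{p}_2M_2+\mathbf{r}$ (otherwise $M_2$ does not exist). Let $\eta_2'=\max\{\mathbf{a}_2\mathbf{x}\mid\mathbf{p}_1\mathbf{x}=k_1+1,\ \mathbf{p}_2\mathbf{x}\le k_2,\ \mathbf{x}\in B_{\mathbf 1}\}$ and $\mu_2'=\min\{\mathbf{a}_2\mathbf{x}\mid\mathbf{p}_1\mathbf{x}=k_1+1,\ \mathbf{p}_2\mathbf{x}\ge k_2+1,\ \mathbf{x}\in B_{\mathbf 1}\}$. If $\lceil\eta_2'\rceil^{+}\le\lfloor\mu_2'\rfloor^{-}$, set $\beta_2'=\lceil\eta_2'\rceil^{+}$ and $\beta_2=\lfloor\mu_2'\rfloor^{-}$ (otherwise $\beta_2',\beta_2$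 do not exist). Step 3. Let $\eta_1=\max\{\mathbf{a}_2\mathbf{x}\mid\mathbf{p}_1\mathbf{x}\le k_1,\ \mathbf{x}\in B_{\mathbf 1}\}$ and $\mu_1=\min\{\mathbf{a}_2\mathbf{x}\mid\mathbf{p}_1\mathbf{x}\ge k_1+2,\ \mathbf{x}\in B_{\mathbf 1}\}$. Set $M_1=\lceil\max(\eta_1-\beta_2',\ \beta_2-\mu_1,\ M_2)\rceil^{+}$, $\mathbf{a}_1=\mathbf{p}_1M_1+\mathbf{a}_2$, $\beta_1'=\beta_2'+(k_1+1)M_1$ and $\beta_1=\beta_2+(k_1+1)M_1$. Step 4. Output $\beta'=\beta_1'$, $\beta=\beta_1$, $\mathbf{a}=\mathbf{a}_1$, $M_1$, $M_2$. Existence of a quantity means that all the linear programs used in defining it are feasible (so their optima exist) and the stated ''if'' conditions hold. The cascade knapsack problem (CKP) is $\{\mathbf{x}\in\mathbb{Z}^n\mid\beta'\le\mathbf{a}\mathbf{x}\le\beta,\ \mathbf{0}\le\mathbf{x}\le\mathbf{1}\}$; its LP relaxation is obtained by replacing $\mathbb{Z}^n$ by $\mathbb{R}^n$. Integer infeasibility of (CKP) means that it contains no point. *)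

(* Defs.v *)
(* R^n is 'rV[R]_n and Z^n is 'rV[int]_n. *)
From HB Require Import structures.
From mathcomp Require Import all_boot all_order all_algebra.
From mathcomp Require Import all_classical all_reals all_analysis.

Set Implicit Arguments.
Unset Strict Implicit.
Unset Printing Implicit Defensive.

Import Order.TTheory GRing.Theory Num.Theory.
Import numFieldNormedType.Exports.
Local Open Scope classical_set_scope.
Local Open Scope ring_scope.

Section Rounding.
Variable R : realType.

Definition floorm (x : R) : int :=
  if x \is a Num.int then Num.floor x - 1 else Num.floor x.

Definition ceilp (x : R) : int :=
  if x \is a Num.int then Num.ceil x + 1 else Num.ceil x.

(* A relation, since the direction of rounding of half-integers is left open. *)
Definition nearest_int (x : R) (k : int) : Prop :=
  forall m : int, `|x - k%:~R| <= `|x - m%:~R|.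

Lemma floormP (x : R) (m : int) : (m <= floorm x) = (m%:~R < x).
Proof.
rewrite /floorm; case: ifPn => xZ.
  by rewrite lerBrDr lezD1 -(ltr_int R) floorK.
rewrite floor_ge_int lt_neqAle.
by case: eqP => // mx; rewrite -mx intr_int in xZ.
Qed.

Lemma ceilpP (x : R) (m : int) : (ceilp x <= m) = (x < m%:~R).
Proof.
rewrite /ceilp; case: ifPn => xZ.
  by rewrite lezD1 -(ltr_int R) ceilK.
rewrite ceil_le_int lt_neqAle.
by case: eqP => // mx; rewrite mx intr_int in xZ.
Qed.

End Rounding.

Section LinearPrograms.
Variables (R : realType) (n : nat).

Definition real_vec (c : 'rV[int]_n) : 'rV[R]_n := map_mx intr c.

Definition dotp (c : 'rV[int]_n) (x : 'rV[R]_n) : R :=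
  \sum_j real_vec c 0 j * x 0 j.

Definition unit_box : set 'rV[R]_n :=
  [set x | forall j, 0 <= x 0 j <= 1].

Definition integer_points : set 'rV[R]_n :=
  [set x | forall j, x 0 j \is a Num.int].

Definition lp_max (S : set 'rV[R]_n) (c : 'rV[int]_n) (v : R) : Prop :=
  (exists2 x, S x & dotp c x = v) /\ (forall y, S y -> dotp c y <= v).

Definition lp_min (S : set 'rV[R]_n) (c : 'rV[int]_n) (v : R) : Prop :=
  (exists2 x, S x & dotp c x = v) /\ (forall y, S y -> v <= dotp c y).

End LinearPrograms.

Arguments unit_box {R n}.
Arguments integer_points {R n}.

Section Optima.
Variables (R : realType) (n : nat).
Implicit Types (c : 'rV[int]_n) (x : 'rV[R]_n).

Lemma dotp_continuous c : continuous (dotp c : 'rV[R]_n -> R).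
Proof.
apply: continuous_big => [|j _ x]; first exact: add_continuous.
by apply: continuousM; [exact: cst_continuous | exact: coord_continuous].
Qed.

Lemma unit_box_compact : compact (@unit_box R n).
Proof.
have := @rV_compact R n (fun=> `[0, 1]%classic) (fun=> @segment_compact R 0 1).
by congr compact; apply/seteqP; split=> x /= xB j; have := xB j;
   rewrite in_itv.
Qed.

(* On closed regions of the box, the linear programs below have an optimum
   exactly when they are feasible. *)
Lemma lp_max_exists (S : set 'rV[R]_n) c :
  closed S -> (exists v, lp_max (S `&` unit_box) c v) <-> S `&` unit_box !=set0.
Proof.
move=> cS; split=> [[v [[x Sx _] _]]|S0]; first by exists x.
have kS : compact (S `&` unit_box).
  by rewrite setIC; apply: compact_closedI => //; exact: unit_box_compact.
have [|x /set_mem Sx xmax] := compact_EVT_max S0 kS (f := dotp c).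
  by apply: continuous_subspaceT; exact: dotp_continuous.
exists (dotp c x); split; first by exists x.
by move=> y Sy; apply: xmax; exact: mem_set.
Qed.

Lemma lp_min_exists (S : set 'rV[R]_n) c :
  closed S -> (exists v, lp_min (S `&` unit_box) c v) <-> S `&` unit_box !=set0.
Proof.
have dN y : dotp (- c) y = - dotp c y :> R.
  rewrite /dotp -sumrN; apply: eq_bigr => j _.
  by rewrite !mxE rmorphN mulNr.
move=> /lp_max_exists-/(_ (- c)) <-; split=> -[v [[x Sx <-] xm]].
  exists (dotp (- c) x); split; first by exists x.
  by move=> y Sy; rewrite !dN lerN2; exact: xm.
exists (dotp c x); split; first by exists x.
by move=> y /xm; rewrite !dN lerN2.
Qed.

End Optima.

Section Procedure.
Variables (R : realType) (n : nat).
Implicit Types (p r a : 'rV[int]_n) (k : int).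

Definition lin_indep p1 p2 : Prop := free [:: real_vec R p1; real_vec R p2].

Definition sublevel p k : set 'rV[R]_n := [set x | dotp p x <= k%:~R].
Definition superlevel p k : set 'rV[R]_n := [set x | k%:~R <= dotp p x].
Definition level p k : set 'rV[R]_n := [set x | dotp p x = k%:~R].

Lemma sublevel_closed p k : closed (sublevel p k).
Proof.
apply: (preimage_closed (f := @dotp R n p) (D := [set y | y <= k%:~R])).
  by move=> x _; exact: dotp_continuous.
exact: closed_le.
Qed.

Lemma superlevel_closed p k : closed (superlevel p k).
Proof.
apply: (preimage_closed (f := @dotp R n p) (D := [set y | k%:~R <= y])).
  by move=> x _; exact: dotp_continuous.
exact: closed_ge.
Qed.

Lemma level_closed p k : closed (level p k).
Proof.
apply: (preimage_closed (f := @dotp R n p) (D := [set y | y = k%:~R])).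
  by move=> x _; exact: dotp_continuous.
exact: closed_eq.
Qed.

Definition ckp_k1 p1 k1 : Prop :=
  exists gamma1 delta1 : R,
    [/\ lp_max unit_box p1 gamma1, lp_min unit_box p1 delta1 &
        nearest_int ((floorm gamma1 + ceilp delta1)%:~R / 2 : R) k1].

Definition ckp_k2 p1 p2 k1 k2 : Prop :=
  exists gamma2 delta2 : R,
    [/\ lp_max (level p1 (k1 + 1) `&` unit_box) p2 gamma2,
        lp_min (level p1 (k1 + 1) `&` unit_box) p2 delta2 &
        nearest_int ((floorm gamma2 + ceilp delta2)%:~R / 2 : R) k2].

Definition ckp_M2 p1 p2 r k1 k2 (M2 : int) : Prop :=
  exists eta2 mu2 : R,
    [/\ lp_max (level p1 (k1 + 1) `&` sublevel p2 k2 `&` unit_box) r eta2,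
        lp_min (level p1 (k1 + 1) `&` superlevel p2 (k2 + 1) `&` unit_box) r mu2,
        1 <= ceilp eta2 - floorm mu2 &
        M2 = ceilp eta2 - floorm mu2].

Definition ckp_beta2 p1 p2 a2 k1 k2 (beta2' beta2 : int) : Prop :=
  exists eta2' mu2' : R,
    [/\ lp_max (level p1 (k1 + 1) `&` sublevel p2 k2 `&` unit_box) a2 eta2',
        lp_min (level p1 (k1 + 1) `&` superlevel p2 (k2 + 1) `&` unit_box)
          a2 mu2',
        ceilp eta2' <= floorm mu2',
        beta2' = ceilp eta2' &
        beta2 = floorm mu2'].

Definition ckp_M1 p1 a2 k1 (M2 beta2' beta2 M1 : int) : Prop :=
  exists eta1 mu1 : R,
    [/\ lp_max (sublevel p1 k1 `&` unit_box) a2 eta1,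
        lp_min (superlevel p1 (k1 + 2) `&` unit_box) a2 mu1 &
        M1 = ceilp (Num.max (Num.max (eta1 - beta2'%:~R) (beta2%:~R - mu1))
                            M2%:~R)].

(* All quantities of the procedure exist, and these are (possible) values of
   k1, k2 and of the outputs. *)
Definition ckp_output p1 p2 r k1 k2 (M1 M2 beta' beta : int) a : Prop :=
  exists beta2' beta2 : int, let a2 := M2 *: p2 + r in
    [/\ ckp_k1 p1 k1 /\ ckp_k2 p1 p2 k1 k2,
        ckp_M2 p1 p2 r k1 k2 M2,
        ckp_beta2 p1 p2 a2 k1 k2 beta2' beta2,
        ckp_M1 p1 a2 k1 M2 beta2' beta2 M1 &
        [/\ a = M1 *: p1 + a2,
            beta' = beta2' + (k1 + 1) * M1 &
            beta = beta2 + (k1 + 1) * M1]].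

Definition ckp_relaxation (beta' beta : int) a : set 'rV[R]_n :=
  [set x | beta'%:~R <= dotp a x <= beta%:~R] `&` unit_box.

End Procedure.

Arguments sublevel {R n}.
Arguments superlevel {R n}.
Arguments level {R n}.
Arguments ckp_relaxation {R n}.

(* Main.v *)
Require Import Defs.
From HB Require Import structures.
From mathcomp Require Import all_boot all_order all_algebra.
From mathcomp Require Import all_classical all_reals all_analysis.
From mathcomp Require Import lra.
Import Order.TTheory GRing.Theory Num.Theory.
Import numFieldNormedType.Exports.
Local Open Scope classical_set_scope.
Local Open Scope ring_scope.

(** The multipliers of the procedure are big-M constants. Put
    a2 = M2 p2 + r, so that a x = M1 (p1 x) + a2 x.

    On the hyperplane p1 x = k1 + 1 the first summand is the constant
    (k1 + 1) M1, by which the window [beta2', beta2] has been shifted to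
    [beta', beta]. There beta2' lies strictly above the maximum of a2 over
    p2 x <= k2 and beta2 strictly below its minimum over p2 x >= k2 + 1, so
    neither side of the p2-branching meets the window
    ([level_branch_infeasible]).

    Off that hyperplane, moving p1 x by one unit moves M1 (p1 x) by M1, which
    is strictly larger than the amount by which a2 x can make up for it:
    eta1 - beta2' when p1 x <= k1, and beta2 - mu1 when p1 x >= k1 + 2. The
    sign M1 > 0, needed to extend this to larger moves, holds because
    M1 > M2 >= 1 ([outer_branch_infeasible]).

    An integer point has integral p1 x and p2 x, hence falls in one of these
    branches. *)

Section Rounding.
Variable R : realType.
Implicit Type x : R.

Lemma lt_ceilp x : x < (ceilp x)%:~R.
Proof. by rewrite -ceilpP. Qed.

Lemma floorm_lt x : (floorm x)%:~R < x.
Proof. by rewrite -floormP. Qed.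

Lemma int_branch x (k : int) :
  x \is a Num.int -> x <= k%:~R \/ (k + 1)%:~R <= x.
Proof.
move=> /intrP[m ->]; rewrite !ler_int lezD1.
by case: (leP m k); [left | right].
Qed.

End Rounding.

Section Dotp.
Variables (R : realType) (n : nat).
Implicit Types (c d : 'rV[int]_n) (x : 'rV[R]_n) (m : int).

Lemma dotpD c d x : dotp (c + d) x = dotp c x + dotp d x.
Proof.
rewrite /dotp -big_split; apply: eq_bigr => j _.
by rewrite !mxE rmorphD mulrDl.
Qed.

Lemma dotpZ m c x : dotp (m *: c) x = m%:~R * dotp c x.
Proof.
rewrite /dotp mulr_sumr; apply: eq_bigr => j _.
by rewrite !mxE rmorphM mulrA.
Qed.

Lemma dotp_int c x : integer_points x -> dotp c x \is a Num.int.
Proof.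
move=> xZ; apply: rpred_sum => j _.
by rewrite rpredM ?xZ// mxE intr_int.
Qed.

End Dotp.

Section Branches.
Variables (R : realType) (n : nat) (p1 : 'rV[int]_n) (k1 : int).
Implicit Type x : 'rV[R]_n.

(** In either branch M1 (p1 x) lies at least M1 below, respectively above, the
    shift (k1 + 1) M1 of the window. Since [ceilp] rounds
    strictly up, M1 exceeds eta1 - beta2' and beta2 - mu1 strictly, so a2 x
    cannot bring the sum back even to an end point of the window. *)
Lemma outer_branch_infeasible (a2 : 'rV[int]_n) (M1 M2 beta2' beta2 : int) x :
  0 <= M2 -> ckp_M1 R p1 a2 k1 M2 beta2' beta2 M1 ->
  ckp_relaxation (beta2' + (k1 + 1) * M1) (beta2 + (k1 + 1) * M1)
    (M1 *: p1 + a2) x ->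
  ~ (dotp p1 x <= k1%:~R \/ (k1 + 2)%:~R <= dotp p1 x).
Proof.
move=> M2_ge0 [eta1 [mu1 [[_ a2_le] [_ a2_ge] M1E]]] [/=].
have := lt_ceilp _ (Num.max (Num.max (eta1 - beta2'%:~R) (beta2%:~R - mu1))
  M2%:~R).
rewrite -M1E !gt_max => /andP[/andP[M1_eta M1_mu] M1_M2].
have M1_gt0 : 0 < M1%:~R :> R by apply: le_lt_trans M1_M2; rewrite ler0z.
move=> + xB p1x; rewrite dotpD dotpZ !rmorphD !rmorphM !rmorphD /=.
move=> /andP[lo hi]; case: p1x => p1x.
- have := a2_le x (conj p1x xB).
  by have := ler_wpM2l (ltW M1_gt0) p1x; lra.
- have := a2_ge x (conj p1x xB).
  by have := ler_wpM2l (ltW M1_gt0) p1x; rewrite rmorphD/=; lra.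
Qed.

(** On the hyperplane the term M1 *: p1 only shifts the window, so the claim is
    that a2 separates both branches from [beta2', beta2]. *)
Lemma level_branch_infeasible (p2 a2 : 'rV[int]_n) (k2 M1 beta2' beta2 : int)
    x :
  ckp_beta2 R p1 p2 a2 k1 k2 beta2' beta2 ->
  ckp_relaxation (beta2' + (k1 + 1) * M1) (beta2 + (k1 + 1) * M1)
    (M1 *: p1 + a2) x ->
  dotp p1 x = (k1 + 1)%:~R ->
  ~ (dotp p2 x <= k2%:~R \/ (k2 + 1)%:~R <= dotp p2 x).
Proof.
move=> [eta2 [mu2 [[_ a2_le] [_ a2_ge] _ -> ->]]] [/= + xB] p1x p2x.
rewrite dotpD dotpZ p1x !rmorphD !rmorphM !rmorphD /= => /andP[lo hi].
case: p2x => p2x.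
- have /a2_le : (level p1 (k1 + 1) `&` sublevel p2 k2 `&` unit_box) x by [].
  by have := lt_ceilp _ eta2; lra.
- have /a2_ge : (level p1 (k1 + 1) `&` superlevel p2 (k2 + 1) `&` unit_box) x.
    by [].
  by have := floorm_lt _ mu2; lra.
Qed.

End Branches.

Theorem lemma3p3 (R : realType) (n : nat) (p1 p2 r : 'rV[int]_n)
    (p12_indep : lin_indep R p1 p2)
    (p1_gt0 : forall j, 0 < p1 0 j) (p2_gt0 : forall j, 0 < p2 0 j)
    (k1 k2 M1 M2 beta' beta : int) (a : 'rV[int]_n)
    (run : ckp_output R p1 p2 r k1 k2 M1 M2 beta' beta a) :
  let Q : set 'rV[R]_n := ckp_relaxation beta' beta a in
  [/\ a = M1 *: p1 + M2 *: p2 + r,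
      forall x, Q x ->
        ~ (dotp p1 x <= k1%:~R \/ (k1 + 2)%:~R <= dotp p1 x),
      forall x, Q x -> dotp p1 x = (k1 + 1)%:~R ->
        ~ (dotp p2 x <= k2%:~R \/ (k2 + 1)%:~R <= dotp p2 x) &
      Q `&` integer_points = set0].
Proof.
case: run => beta2' [beta2 [_ M2P beta2P M1P [-> -> ->]]] Q.
have M2_ge0 : 0 <= M2 by case: M2P => eta2 [mu2 [_ _ + ->]]; exact: le_trans.
have outer x := outer_branch_infeasible R n _ _ _ _ _ _ _ x M2_ge0 M1P.
have inner x := level_branch_infeasible R n _ _ _ _ _ M1 _ _ x beta2P.
split=> [|//|//|]; first by rewrite addrA.
rewrite -subset0 => x [Qx xZ].
have p1x : dotp p1 x = (k1 + 1)%:~R.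
  have p1Z := dotp_int _ _ p1 _ xZ.
  apply/eqP; rewrite eq_le; apply/andP; split.
    have [//|p1x] := int_branch _ _ (k1 + 1) p1Z.
    by case: (outer x Qx); right; rewrite -addrA in p1x.
  have [p1x|//] := int_branch _ _ k1 p1Z.
  by case: (outer x Qx); left.
exact: inner x Qx p1x (int_branch _ _ k2 (dotp_int _ _ p2 _ xZ)).
Qed.
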